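(* Let $(\Omega,\mu,d)$ be a metric measure space, let $J\ge0$ be a kernel on $\Omega\times\Omega$ satisfying, for some $R>0$, $$J(x,y)>0\quad\text{for all }x,y\in\Omega\text{ such that }d(x,y)<R,$$ and let $K_Ju(x)=\int_\Omega J(x,y)u(y)\,dy$. If $z\ge0$ is a nontrivial measurable function defined in $\Omega$, then $$P(K_J^n(z))\supset P_R^n(z)\quad\text{for all }n\in\mathbb N.$$ In particular, if $\Omega$ is $R$-connected, then for any compact set $\mathcal K\subset\Omega$ there exists $n_0(z)\in\mathbb N$ such that $P(K_J^n(z))\supset\mathcal K$ for all $n\ge n_0(z)$. If $\Omega$ is compact and connected, then there exists $n_0\in\mathbb N$ such that, for all measurable $z\ge0$ not identically zero, $P(K_J^n(z))=\Omega$ for all $n\ge n_0$.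
   Context: A metric measure space $(\Omega,\mu,d)$ is a metric space $(\Omega,d)$ with a $\sigma$-finite, regular, complete Borel measure $\mu$ that associates a finite positive measure to the balls of $\Omega$. Integration $dy$ is with respect to $\mu$; $B(x,\delta)$ is the ball of center $x$ and radius $\delta$. For a nonnegative measurable $z:\Omega\to\mathbb R$, the essential support of $z$ is $P(z)=\{x\in\Omega:\ \forall\delta>0,\ \mu(\{y\in\Omega: z(y)>0\}\cap B(x,\delta))>0\}$. For $R>0$ define $P^0(z)=P(z)$, $P_R^1(z)=\bigcup_{x\in P^0(z)}B(x,R)$, and $P_R^n(z)=\bigcup_{x\in P_R^{n-1}(z)}B(x,R)$ for $n\ge2$. Functions are understood up to sets of measure zero, so ''nontrivial'' (not identically zero) means $\mu(\{z>0\})>0$, equivalently $P(z)\neq\emptyset$. $\Omega$ is $R$-connected if for any $x,y\in\Omega$ there exist $N\in\mathbb N$ and points $x_0,\dots,x_N\in\Omega$ with $x_0=x$, $x_N=y$ and $d(x_{i-1},x_i)<R$ for $i=1,\dots,N$. *)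

(* Defs.v *)
From HB Require Import structures.
From mathcomp Require Import all_boot all_order all_algebra.
From mathcomp Require Import all_classical all_reals all_analysis.
From mathcomp Require Import measurable_realfun.

Set Implicit Arguments.
Unset Strict Implicit.
Unset Printing Implicit Defensive.

Import Order.TTheory GRing.Theory Num.Theory.
Import numFieldTopology.Exports.

Local Open Scope classical_set_scope.
Local Open Scope ring_scope.
Local Open Scope ereal_scope.

(* A metric space with a sigma-algebra.  The two structures are related only
   by the field mms_borel of metric_measure_space below. *)
#[short(type="metricMeasurableType")]
HB.structure Definition MetricMeasurable (d : measure_display) (R : realType) :=
  { T of Metric R T & Measurable d T }.

Section MetricMeasureSpace.
Context (d : measure_display) (R : realType) (T : metricMeasurableType d R).
Implicit Types (mu : set T -> \bar R) (u : T -> \bar R).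

Definition outer_regular mu (A : set T) :=
  mu A = ereal_inf [set mu U | U in [set U | open U /\ A `<=` U]].

Definition inner_regular mu (A : set T) :=
  mu A = ereal_sup [set mu C | C in [set C | compact C /\ C `<=` A]].

(* The sigma-algebra is not required to be the Borel one, which is rarely
   complete: it contains the open sets and, by regularity, is then the
   completion of the Borel sigma-algebra. *)
Record metric_measure_space (mu : {sigma_finite_measure set T -> \bar R}) :
    Prop := MetricMeasureSpace {
  mms_borel : forall U : set T, open U -> measurable U ;
  mms_complete : measure_is_complete mu ;
  mms_regular : forall A : set T, measurable A ->
    outer_regular mu A /\ inner_regular mu A ;
  mms_ball : forall (x : T) (r : R), (0 < r)%R -> 0 < mu (ball x r) < +oo
}.

Definition essential_support mu u : set T :=
  [set x | forall delta : R, (0 < delta)%R ->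
    0 < mu ([set y | 0 < u y] `&` ball x delta)].

Fixpoint iterated_support mu (r : R) (n : nat) u : set T :=
  if n is m.+1 then \bigcup_(x in iterated_support mu r m u) ball x r
  else essential_support mu u.

(* Measurability with respect to the completion of the product
   sigma-algebra; J x is then a measurable function for almost every x only. *)
Definition jointly_measurable (mu : {sigma_finite_measure set T -> \bar R})
    (J : T -> T -> R) : Prop :=
  measurable_fun
    [set: g_sigma_algebraType (completed_algebra_gen (mu \x mu))]
    (fun xy : T * T => J xy.1 xy.2).

(* The integral of a nonnegative function may be +oo, hence the codomain. *)
Definition kernel_op mu (J : T -> T -> R) u : T -> \bar R :=
  fun x => \int[mu]_y ((J x y)%:E * u y).

End MetricMeasureSpace.

Definition chain_connected (R : realType) (T : metricType R) (r : R) : Prop :=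
  forall x y : T, exists (N : nat) (s : nat -> T),
    [/\ s 0%N = x, s N = y &
        forall i : nat, (i < N)%N -> (mdist (s i) (s i.+1) < r)%R].

(* Main.v *)
Require Import Defs.
From HB Require Import structures.
From mathcomp Require Import all_boot all_order all_algebra.
From mathcomp Require Import all_classical all_reals all_analysis.
From mathcomp Require Import measurable_realfun.

Set Implicit Arguments.
Unset Strict Implicit.
Unset Printing Implicit Defensive.

Import Order.TTheory GRing.Theory Num.Theory.
Import numFieldTopology.Exports.

Local Open Scope classical_set_scope.
Local Open Scope ring_scope.

(** Everything rests on one step: the [r]-neighbourhood of [P(u)] lies in
[P(K_J u)] ([enlarge_essential_support]).  If [x] is in [P(u)] and [d(x, y) < r],
then for [y'] close to [y] the kernel [J y'] is positive on a small ball around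
[x], and [u] is positive on a non-null part of this ball, hence
[K_J u (y') > 0].  Iterating gives [P_R^n(z)] inside [P(K_J^n z)].

The measure-theoretic difficulty is that [J] is measurable only for the
completion of the product sigma-algebra.  So [J y'] is measurable for almost
every [y'] only, and it must be shown that [K_J u] is measurable again, since
otherwise the measure of its positivity set is meaningless.  Both facts come
from replacing [J] by a product-measurable function that is equal to it almost
everywhere ([completed_measurable_ae_eq]); almost every section of the
exceptional set is null ([ae_product_section]), so that Tonelli's theorem and
the completeness of [mu] apply ([ae_measurable_kernel],
[measurable_kernel_op]).

The rest is geometry of the operation [enlarge], which adds to a set the open
[r]-balls around its points.  The iterates of [enlarge] on a nonempty set
increase to the whole space when the space is [r]-connected, and also when it is
connected, their union being then open and closed.  From the first iterate on
they are open, so that a compact set is swallowed after finitely many steps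
([compact_sub_iter_enlarge]).  It is applied to [P(z)], which is nonempty by
inner regularity ([essential_support_nonempty]).

For the bound that is uniform in [z], fix a point [x0] and [n0] such that every
point is reached from [x0] in [n0] steps.  Steps are reversible, so [x0] is
reached in [n0] steps from any point of [P(z)], and [n0 + n0] steps suffice for
every [z]. *)

(** * Neighbourhoods of radius r and their iterates *)

Section enlargement.
Context (R : realType) (T : metricType R) (r : R).
Hypothesis hr : 0 < r.
Implicit Types A C : set T.

Definition enlarge A : set T := \bigcup_(x in A) ball x r.

Lemma metric_ball_open (x : T) (e : R) : open (ball x e).
Proof.
rewrite openE => y; rewrite ballEmdist /= => xy.
apply/nbhs_ballP; exists (e - mdist x y) => /=; first by rewrite subr_gt0.
move=> z; rewrite !ballEmdist /= => yz.
by rewrite (le_lt_trans (metric_triangle x y z))// -ltrBrDl.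
Qed.

Lemma open_enlarge A : open (enlarge A).
Proof. by apply: bigcup_open => x _; exact: metric_ball_open. Qed.

Lemma sub_enlarge A : A `<=` enlarge A.
Proof. by move=> x Ax; exists x => //; exact: ballxx. Qed.

Lemma enlargeS A B : A `<=` B -> enlarge A `<=` enlarge B.
Proof. exact: bigcup_subset. Qed.

Lemma iter_enlargeS n A B : A `<=` B -> iter n enlarge A `<=` iter n enlarge B.
Proof. by move=> AB; elim: n => //= n; exact: enlargeS. Qed.

Lemma iter_enlarge_mono A m n : (m <= n)%N ->
  iter m enlarge A `<=` iter n enlarge A.
Proof.
move=> /subnK <-; elim: (n - m)%N => // k IH.
exact: subset_trans IH (@sub_enlarge _).
Qed.

Lemma iter_enlarge_sym n (x y : T) :
  iter n enlarge [set x] y -> iter n enlarge [set y] x.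
Proof.
elim: n x y => [|n IH] x y /=; first by move=> ->.
move=> [w /IH yw wy]; rewrite -/(iter n.+1 enlarge [set y] x) iterSr.
apply: iter_enlargeS yw => _ ->; exists y => //; exact: ball_sym.
Qed.

(** The iterates increase, and each point of the [k]-th one is interior to the
next, so they form a covering to which the filter form of compactness applies. *)
Lemma compact_sub_iter_enlarge A C : compact C ->
  C `<=` \bigcup_n iter n enlarge A ->
  exists n0, forall n, (n0 <= n)%N -> C `<=` iter n enlarge A.
Proof.
move=> /compact_near_coveringP cC CA.
suff [n0 _ n0P] : \forall n \near \oo, C `<=` iter n enlarge A.
  by exists n0 => n; exact: n0P.
apply: (cC nat \oo (fun n => iter n enlarge A)) => x /CA[k _ xk].
(* The zeroth iterate [A] need not be open, hence the shift by one. *)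
have : nbhs x (iter k.+1 enlarge A).
  apply: open_nbhs_nbhs; split; first exact: open_enlarge.
  exact: sub_enlarge.
move=> xk1; exists (iter k.+1 enlarge A, [set n | k.+1 <= n]%N) => /=.
  by split => //; exists k.+1.
by move=> [y n] [/= yk kn]; exact: iter_enlarge_mono kn _ yk.
Qed.

Lemma chain_iter_enlarge (s : nat -> T) n :
  (forall i, (i < n)%N -> mdist (s i) (s i.+1) < r) ->
  iter n enlarge [set s 0%N] (s n).
Proof.
elim: n => [//|n IH] sr; exists (s n); first by apply: IH => i /ltnW; exact: sr.
by rewrite ballEmdist; exact: sr.
Qed.

Lemma chain_connected_cover A : chain_connected T r -> A !=set0 ->
  \bigcup_n iter n enlarge A = setT.
Proof.
move=> cT [a Aa]; rewrite -subTset => x _.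
have [n [s [s0 sn sr]]] := cT a x; exists n => //.
apply: (@iter_enlargeS _ [set a]); first by move=> _ ->.
by rewrite -s0 -sn; exact: chain_iter_enlarge.
Qed.

(** The union is closed: a point adherent to it is at distance less than [r]
from a point of some iterate, hence belongs to the next one. *)
Lemma connected_cover A : connected [set: T] -> A !=set0 ->
  \bigcup_n iter n enlarge A = setT.
Proof.
move=> cT [a Aa]; apply: cT.
- by exists a, 0%N.
- exists (\bigcup_n iter n enlarge A); last by rewrite setTI.
  rewrite openE => x [n _ nx].
  apply: (@filterS _ _ _ (iter n.+1 enlarge A)); last first.
    by apply: open_nbhs_nbhs; split; [exact: open_enlarge|exact: sub_enlarge].
  by move=> y ny; exists n.+1.
- exists (\bigcup_n iter n enlarge A); last by rewrite setTI.
  move=> x /(_ _ (nbhsx_ballx x r hr))[y [[n _ ny] xy]].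
  by exists n.+1 => //; exists y => //; exact: ball_sym.
Qed.

End enlargement.

(** * Measurability up to null sets for a completed sigma-algebra *)

Section completion.
Context d (X : measurableType d) (R : realType) (m : {measure set X -> \bar R}).
Local Open Scope ereal_scope.

(** The sets that agree almost everywhere with a measurable set form a
sigma-algebra containing the generators of the completion. *)
Lemma completed_ae_eq_measurable (E : set X) :
  <<s completed_algebra_gen m >> E ->
  exists2 A, measurable A & \forall x \ae m, E x <-> A x.
Proof.
move: E; apply: smallest_sub; first split => /=.
- by exists set0 => //; exact: aeW.
- move=> E [A mA EA]; exists (~` A); first exact: measurableC.
  apply: filterS EA => x EA.
  by split=> [[_ nE] /EA//|nA]; split=> // /EA.
- move=> E /= EA.
  have /choice[A hA] : forall n, exists A, measurable A /\
      \forall x \ae m, E n x <-> A x.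
    by move=> n; have [A ? ?] := EA n; exists A.
  exists (\bigcup_n A n).
    by apply: bigcupT_measurable => n; exact: (hA n).1.
  have : \forall x \ae m, forall n, E n x <-> A n x.
    by apply: ae_foralln => n; exact: (hA n).2.
  apply: filterS => x EAx.
  by split=> -[n _ /EAx ?]; exists n.
- move=> _ [A mA [N [B [mB B0 NB]] <-]]; exists A => //.
  exists B; split => // x /= nAN; apply: NB; apply: contrapT => nNx.
  by apply: nAN; split => [[//|//]|]; left.
Qed.

(** A nonnegative function is the supremum of the functions [c 1_{f > c}] over
a countable dense set of levels [c >= 0]; replacing each [{f > c}] by a measurable
set that agrees with it almost everywhere yields [g]. *)
Lemma completed_measurable_ae_eq (f : X -> R) :
  measurable_fun [set: g_sigma_algebraType (completed_algebra_gen m)] f ->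
  (forall x, 0 <= f x)%R ->
  exists g : X -> \bar R, [/\ measurable_fun setT g, forall x, 0 <= g x &
    \forall x \ae m, (f x)%:E = g x].
Proof.
move=> mf f0.
(* Negative rationals and indices that encode no rational give the level 0,
   which keeps every term of the supremum nonnegative. *)
pose c k : R := (Num.max 0 (ratr (odflt 0 (unpickle k : option rat))))%R.
have c0 k : (0 <= c k)%R by rewrite le_max lexx.
have /choice[A hA] : forall k, exists A : set X, measurable A /\
    \forall x \ae m, (c k < f x)%R <-> A x.
  move=> k; have := mf measurableT _ (measurable_itv `]c k, +oo[).
  rewrite setTI => /completed_ae_eq_measurable[A mA Ax].
  by exists A; split => //; apply: filterS Ax => x; rewrite /= in_itv/= andbT.
pose h k x := (c k * \1_(A k) x)%:E.
exists (fun x => esups (h ^~ x) 0%N); split.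
- apply: measurable_fun_esups => k; apply/measurable_EFinP.
  apply: measurable_funM => //.
  exact: measurable_indic (hA k).1.
- move=> x; apply: le_trans (ereal_sup_ubound _); last by exists 0%N.
  by rewrite lee_fin mulr_ge0.
have : \forall x \ae m, forall k, (c k < f x)%R <-> A k x.
  by apply: ae_foralln => k; exact: (hA k).2.
apply: filterS => x cA; apply/eqP; rewrite eq_le; apply/andP; split; last first.
  apply: ge_ereal_sup => _ [k _ <-]; rewrite lee_fin indicE.
  case: (boolP (x \in A k)) => [|_]; last by rewrite mulr0.
  by rewrite inE => /cA/ltW; rewrite mulr1.
apply/lee_subgt0Pr => e e0; rewrite -EFinB.
have [fe|fe] := leP 0%R (f x - e)%R; last first.
  apply: le_trans (ereal_sup_ubound _); last by exists 0%N.
  rewrite lee_fin (le_trans (ltW fe))// mulr_ge0//.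
have /rat_in_itvoo[q] : (f x - e < f x)%R by rewrite ltrBlDr ltrDl.
rewrite in_itv/= => /andP[eq qf].
have cq : c (pickle q) = ratr q.
  by rewrite /c pickleK/=; apply/max_idPr; exact: le_trans (ltW eq).
apply: (@le_trans _ _ (h (pickle q) x)); last first.
  by apply: ereal_sup_ubound; exists (pickle q).
rewrite lee_fin cq indicE mem_set ?mulr1; first exact: ltW.
by apply/cA; rewrite cq.
Qed.

End completion.

(** * Sections of a null set of a product *)

Section product.
Context d1 d2 (X : measurableType d1) (Y : measurableType d2) (R : realType).
Context (m1 : {measure set X -> \bar R}).
Context (m2 : {sigma_finite_measure set Y -> \bar R}).
Local Open Scope ereal_scope.

(** The product measure of a null set is the integral of the measures of its
sections, which therefore vanish almost everywhere. *)
Lemma ae_product_section (P : X * Y -> Prop) :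
  (\forall p \ae m1 \x m2, P p) ->
  \forall x \ae m1, \forall y \ae m2, P (x, y).
Proof.
move=> [N [mN N0 PN]].
have mNx := measurable_fun_xsection m2 mN.
have : ae_eq m1 setT (m2 \o xsection N) (cst 0).
  apply/(ae_eq_integral_abs _ measurableT) => //.
  rewrite -[RHS]N0; apply: eq_integral => x _.
  by rewrite gee0_abs.
apply: filterS => x /(_ I)/= Nx0.
exists (xsection N x); split => //; first exact: measurable_xsection.
by move=> y /= Pxy; rewrite xsectionE; exact: PN.
Qed.

End product.

(** * The integral operator and essential supports *)

Section kernel.
Context (d : measure_display) (R : realType) (T : metricMeasurableType d R).
Context (mu : {sigma_finite_measure set T -> \bar R}).
Hypothesis hmu : metric_measure_space mu.
Context (J : T -> T -> R).
Hypotheses (hJm : jointly_measurable mu J) (hJ0 : forall x y : T, 0 <= J x y).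
Local Open Scope ereal_scope.

Lemma kernel_op_ge0 u (x : T) : (forall y, 0 <= u y) -> 0 <= kernel_op mu J u x.
Proof. by move=> u0; apply: integral_ge0 => y _; rewrite mule_ge0 ?lee_fin. Qed.

Lemma iter_kernel_op_ge0 n u (x : T) :
  (forall y, 0 <= u y) -> 0 <= iter n (kernel_op mu J) u x.
Proof.
by move=> u0; elim: n x => [|n IH] x //=; exact: kernel_op_ge0.
Qed.

Lemma kernel_ae_eq_measurable : exists g : T * T -> \bar R,
  [/\ measurable_fun setT g, forall p, 0 <= g p &
   \forall x \ae mu, \forall y \ae mu, (J x y)%:E = g (x, y)].
Proof.
have [g [mg g0 Jg]] := completed_measurable_ae_eq hJm (fun p => hJ0 p.1 p.2).
by exists g; split => //; exact: ae_product_section Jg.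
Qed.

Lemma ae_measurable_kernel : \forall x \ae mu, measurable_fun setT (EFin \o J x).
Proof.
have [g [mg _ Jg]] := kernel_ae_eq_measurable.
apply: filterS Jg => x Jgx.
apply: (ae_measurable_fun (mms_complete hmu)
  (f := fun y => g (x, y)) (D := setT)).
  by apply: filterS Jgx => y + _ => /esym.
exact: measurableT_comp.
Qed.

(** Tonelli's theorem gives the measurability of the integral with [J] replaced
by its product-measurable version; this integral equals [kernel_op mu J u] almost
everywhere, which is enough as [mu] is complete. *)
Lemma measurable_kernel_op u : measurable_fun setT u -> (forall y, 0 <= u y) ->
  measurable_fun setT (kernel_op mu J u).
Proof.
move=> m_u u0; have [g [mg g0 Jg]] := kernel_ae_eq_measurable.
pose F := fubini_F mu (fun p : T * T => g p * u p.2).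
have mgu : measurable_fun setT (fun p : T * T => g p * u p.2).
  by apply: emeasurable_funM => //; exact: measurableT_comp.
apply: (ae_measurable_fun (mms_complete hmu) (f := F) (D := setT)); last first.
  apply: measurable_fun_fubini_tonelli_F => // p.
  by rewrite mule_ge0.
apply: filterS2 Jg ae_measurable_kernel => x Jgx mJx _.
apply: ge0_ae_eq_integral => //.
- exact: (measurableT_comp mgu).
- exact: emeasurable_funM.
- by move=> y _; rewrite mule_ge0.
- by move=> y _; rewrite mule_ge0// lee_fin.
- by apply: filterS Jgx => y /= -> _.
Qed.

Lemma measurable_iter_kernel_op n u :
  measurable_fun setT u -> (forall y, 0 <= u y) ->
  measurable_fun setT (iter n (kernel_op mu J) u).
Proof.
move=> m_u u0; elim: n => [|n IH] //=.
by apply: measurable_kernel_op => // y; exact: iter_kernel_op_ge0.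
Qed.

Lemma measurable_mball (x : T) (e : R) : measurable (ball x e).
Proof. exact: (mms_borel hmu (metric_ball_open x e)). Qed.

Lemma measurable_pos_ball (u : T -> \bar R) (x : T) (e : R) :
  measurable_fun setT u ->
  measurable ([set y | 0 < u y] `&` ball x e).
Proof.
move=> m_u; apply: measurableI; last exact: measurable_mball.
by rewrite -[X in measurable X]setTI; exact: emeasurable_fun_o_infty.
Qed.

(** A nonnegative measurable function with zero integral vanishes almost
everywhere, whereas [J x * u] is positive on [{u > 0}] intersected with [B]. *)
Lemma kernel_op_gt0 u x (B : set T) :
  measurable_fun setT u -> (forall y, 0 <= u y) ->
  measurable_fun setT (EFin \o J x) ->
  measurable ([set y | 0 < u y] `&` B) ->
  0 < mu ([set y | 0 < u y] `&` B) -> (forall y, B y -> (0 < J x y)%R) ->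
  0 < kernel_op mu J u x.
Proof.
move=> m_u u0 mJx mB uB JB.
rewrite lt0e kernel_op_ge0 // andbT; apply/eqP => K0.
have : ae_eq mu setT (fun y => (J x y)%:E * u y) (cst 0).
  apply/(ae_eq_integral_abs _ measurableT); first exact: emeasurable_funM.
  rewrite -K0; apply: eq_integral => y _.
  by rewrite gee0_abs// mule_ge0// lee_fin.
move=> /(negligibleS _)-/(_ ([set y | 0 < u y] `&` B)) Jneg.
move: uB; rewrite (measure_negligible mB) ?ltxx//; apply: Jneg.
move=> y [/= uy By] /(_ I) /eqP; rewrite mule_eq0 eqe => /orP[]/eqP Juy0.
- by have := JB _ By; rewrite Juy0 ltxx.
- by rewrite Juy0 ltxx in uy.
Qed.

(** Around a point [y] with [d(x, y) < r], the slack [r - d(x, y)] is shared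
equally between a ball around [y] and a ball around [x]: [J] is positive on their
product.  Hence [K_J u > 0] at each point of the ball around [y] for which
[J] has a measurable section. *)
Lemma enlarge_essential_support (r : R) u :
  (forall x y : T, mdist x y < r -> 0 < J x y)%R ->
  measurable_fun setT u -> (forall y, 0 <= u y) ->
  enlarge r (essential_support mu u) `<=`
  essential_support mu (kernel_op mu J u).
Proof.
move=> hJr m_u u0 y [x Px]; rewrite ballEmdist /= => xy delta delta0.
pose e : R := ((r - mdist x y) / 2)%R.
have e0 : (0 < e)%R by rewrite divr_gt0// subr_gt0.
have Jpos y' x' : ball y e y' -> ball x e x' -> (0 < J y' x')%R.
  rewrite !ballEmdist /= => yy' xx'; apply: hJr.
  rewrite (le_lt_trans (metric_triangle y' x x'))//.
  rewrite (le_lt_trans (lerD (metric_triangle y' y x) (lexx _)))//.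
  have -> : r = (e + mdist x y + e)%R by rewrite addrAC /e -splitr subrK.
  by rewrite ltrD// metric_sym (metric_sym y x) ltrD2r.
have de0 : (0 < Num.min delta e)%R by rewrite lt_min delta0.
have /andP[B0 _] := mms_ball hmu y de0.
rewrite lt0e measure_ge0 andbT; apply/eqP => mu0.
have mK := measurable_kernel_op m_u u0.
(* If [K_J u] were positive on a null subset only, then the ball around [y]
   would be covered by this set and the points with a nonmeasurable section. *)
suff : mu.-negligible (ball y (Num.min delta e)).
  move=> /(measure_negligible (measurable_mball _ _)) muB0.
  by rewrite muB0 ltxx in B0.
have : mu.-negligible ([set y0 | 0 < kernel_op mu J u y0] `&` ball y delta).
  by apply/negligibleP => //; exact: measurable_pos_ball.
move=> /negligibleU /(_ ae_measurable_kernel); apply: negligibleS => y' yy'.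
have [mJ|] := pselect (measurable_fun setT (EFin \o J y')); last by right.
left; split; last first.
  by apply: le_ball yy'; rewrite ge_min lexx.
apply: (kernel_op_gt0 (B := ball x e)) => //.
- exact: measurable_pos_ball.
- exact: Px.
- by move=> x'; apply: Jpos; apply: le_ball yy'; rewrite ge_min lexx orbT.
Qed.

Lemma iterated_supportE (r : R) n (u : T -> \bar R) :
  iterated_support mu r n u = iter n (enlarge r) (essential_support mu u).
Proof. by elim: n => //= n ->. Qed.

Lemma iterated_support_sub (r : R) n u :
  (forall x y : T, mdist x y < r -> 0 < J x y)%R ->
  measurable_fun setT u -> (forall y, 0 <= u y) ->
  iterated_support mu r n u `<=`
  essential_support mu (iter n (kernel_op mu J) u).
Proof.
move=> hJr m_u u0; rewrite iterated_supportE.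
elim: n => //= n IH; apply: subset_trans (enlargeS IH) _.
apply: enlarge_essential_support => //.
  exact: measurable_iter_kernel_op.
by move=> y; exact: iter_kernel_op_ge0.
Qed.

(** By inner regularity [{u > 0}] contains a compact set [C] of positive measure.
The conull subsets of [C] generate a proper filter, and any of its cluster points
in [C] belongs to the essential support: otherwise the complement of some ball
around it would be in the filter. *)
Lemma essential_support_nonempty (u : T -> \bar R) : measurable_fun setT u ->
  0 < mu [set y | 0 < u y] -> essential_support mu u !=set0.
Proof.
move=> m_u; set Z := [set y | _].
have mZ : measurable Z.
  by rewrite -[Z]setTI; exact: emeasurable_fun_o_infty.
rewrite (mms_regular hmu mZ).2 => /ereal_sup_gt[_ [C [cC CZ] <-] C0].
have mC : measurable C.
  rewrite -[C]setCK; apply: measurableC; apply: (mms_borel hmu).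
  exact/closed_openC/(compact_closed (@metric_hausdorff _ T)).
have FC : ProperFilter (within C (almost_everywhere mu)).
  split; last exact: within_filter.
  move=> Cneg; have : mu.-negligible C.
    by apply: negligibleS Cneg => x Cx /(_ Cx).
  by move=> /(measure_negligible mC) muC; rewrite muC ltxx in C0.
have [|p [Cp clp]] := cC _ FC; first exact: withinT.
exists p => delta delta0; rewrite lt0e measure_ge0 andbT; apply/eqP => mu0.
have [||q [nBq Bq]] := clp (~` ball p delta) (ball p delta) => //.
- have : mu.-negligible (Z `&` ball p delta).
    by apply/negligibleP => //; exact: measurable_pos_ball.
  apply: negligibleS => x /= /not_implyP[Cx /contrapT Bx].
  by split => //; exact: CZ.
- exact: nbhsx_ballx.
Qed.

End kernel.

Theorem proposition3p14
    (d : measure_display) (R : realType) (T : metricMeasurableType d R)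
    (mu : {sigma_finite_measure set T -> \bar R})
    (hmu : metric_measure_space mu)
    (J : T -> T -> R) (hJm : jointly_measurable mu J)
    (hJ0 : forall x y : T, 0 <= J x y)
    (r : R) (hr : 0 < r)
    (hJr : forall x y : T, mdist x y < r -> 0 < J x y) :
  (forall z : T -> R,
     measurable_fun [set: T] z -> (forall x : T, 0 <= z x) ->
     (0 < mu [set x | (0 < z x)%R])%E ->
     (forall n : nat,
        iterated_support mu r n (EFin \o z) `<=`
        essential_support mu (iter n (kernel_op mu J) (EFin \o z)))
     /\
     (chain_connected T r ->
      forall C : set T, compact C ->
      exists n0 : nat, forall n : nat, (n0 <= n)%N ->
        C `<=` essential_support mu (iter n (kernel_op mu J) (EFin \o z))))
  /\
  (compact [set: T] -> connected [set: T] ->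
   exists n0 : nat, forall z : T -> R,
     measurable_fun [set: T] z -> (forall x : T, 0 <= z x) ->
     (0 < mu [set x | (0 < z x)%R])%E ->
     forall n : nat, (n0 <= n)%N ->
       essential_support mu (iter n (kernel_op mu J) (EFin \o z)) = [set: T]).
Proof.
have supp (z : T -> R) : measurable_fun [set: T] z -> (forall x : T, 0 <= z x) ->
    (0 < mu [set x | (0 < z x)%R])%E ->
    essential_support mu (EFin \o z) !=set0 /\
    forall n : nat, iter n (enlarge r) (essential_support mu (EFin \o z)) `<=`
      essential_support mu (iter n (kernel_op mu J) (EFin \o z)).
  move=> mz z0 zpos; have mEz : measurable_fun [set: T] (EFin \o z).
    exact/measurable_EFinP.
  split.
    exact: essential_support_nonempty.
  move=> n; rewrite -iterated_supportE.
  by apply: iterated_support_sub => // y; rewrite lee_fin.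
split=> [z mz z0 zpos|cT connT].
  have [P0 sub] := supp z mz z0 zpos.
  split=> [n|cc C cC]; first by rewrite iterated_supportE; exact: sub.
  have [|n0 Cn] := @compact_sub_iter_enlarge _ _ _ hr
      (essential_support mu (EFin \o z)) C cC.
    by rewrite chain_connected_cover.
  by exists n0 => n /Cn CE; apply: subset_trans CE (sub n).
have [[x0 _]|T0] := pselect ([set: T] !=set0); last first.
  exists 0%N => z _ _ _ n _; apply/seteqP; split => // x _.
  by exfalso; apply: T0; exists x.
have [|n0 Tn] := @compact_sub_iter_enlarge _ _ _ hr [set x0] _ cT.
  by rewrite connected_cover //; exists x0.
exists (n0 + n0)%N => z mz z0 zpos n n0n.
have [[p Pp] sub] := supp z mz z0 zpos.
rewrite -subTset; apply: subset_trans (sub n).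
apply: subset_trans (iter_enlarge_mono hr n0n).
rewrite iterD; apply: subset_trans (Tn n0 (leqnn _)) _.
apply: iter_enlargeS => _ ->.
apply: (@iter_enlargeS _ _ _ _ [set p]); first by move=> _ ->.
apply: iter_enlarge_sym; exact: Tn.
Qed.
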